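(* Let $\nu>-1$ and let $N\ge 0$ be an integer. Suppose that $c>0$ and that $f\in \mathcal{C}^2((0,1))$ is such that $f(0)=0$. Then $$\mathcal{H}_{c,N,\nu}\circ L_{c,N,\nu}(f)(x)=L_{c,N,\nu}\circ\mathcal{H}_{c,N,\nu}(f)(x).$$
   Context: $J_N$ denotes the Bessel function of the first kind of order $N$, and $\mathcal{J}_N(x):=\sqrt{x}\,J_N(x)$. $L^2_\nu(0,1)$ denotes the Hilbert space $L^2((0,1),(1-t^2)^\nu dt)$. The weighted finite Hankel transform is the integral operator $$\mathcal{H}_{c,N,\nu}(f)(x)=\int_0^1 \mathcal{J}_N(cxt)\,f(t)\,(1-t^2)^\nu\,dt,\qquad f\in L^2_\nu(0,1).$$ The differential operator $L_{c,N,\nu}$ is $$L_{c,N,\nu}=(1-x^2)\frac{d^2}{dx^2}-2(\nu+1)x\frac{d}{dx}+\frac{\frac14-N^2}{x^2}-c^2x^2 .$$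
   Formalization: f(0)=0 is read as f(t)→0 as t→0+; f∈L²_ν and existence of H(Lf)(x) are assumed; since the claim fails otherwise, (1−t²)^{ν+1}f′(t)→0 as t→1 and, for N=0, f(t)=o(√t ln t) as t→0 are added. *)

(* Defs.v *)
From HB Require Import structures.
From mathcomp Require Import all_boot all_order all_algebra.
From mathcomp Require Import all_classical all_reals all_analysis.

Set Implicit Arguments.
Unset Strict Implicit.
Unset Printing Implicit Defensive.

Import Order.TTheory GRing.Theory Num.Theory.
Import numFieldNormedType.Exports.

Local Open Scope classical_set_scope.
Local Open Scope ring_scope.

Section WeightedFiniteHankel.
Context {R : realType}.
Implicit Types (c nu x t : R) (N : nat) (f g : R -> R).

(* The power series of J_N converges for every x, so [limn] is its sum. *)
Definition besselJ N x : R :=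
  limn (series (fun k : nat =>
    (-1) ^+ k / (k`! * (k + N)`!)%:R * (x / 2) ^+ (2 * k + N))).

Definition sqrt_besselJ N x : R := Num.sqrt x * besselJ N x.

Definition weight nu t : R := (1 - t ^+ 2) `^ nu.

Definition in_L2 nu f : Prop :=
  measurable_fun (`]0, 1[ : set R) f /\
  (@lebesgue_measure R).-integrable `]0, 1[
    (fun t => (f t ^+ 2 * weight nu t)%:E).

Definition hankel_integrand c N nu g x t : R :=
  sqrt_besselJ N (c * x * t) * g t * weight nu t.

Definition hankel c N nu g x : R :=
  \int[@lebesgue_measure R]_(t in `]0, 1[) hankel_integrand c N nu g x t.

(* [\int] has a conventional value when its integrand is not integrable; this
   predicate says that the integral defining [hankel c N nu g x] exists.
   It holds for every x in ]0, 1[ as soon as [in_L2 nu g] does. *)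
Definition hankel_defined c N nu g x : Prop :=
  (@lebesgue_measure R).-integrable `]0, 1[
    (fun t => (hankel_integrand c N nu g x t)%:E).

Definition Lop c N nu f x : R :=
  (1 - x ^+ 2) * f^`(2)%classic x - 2 * (nu + 1) * x * f^`()%classic x
  + (4^-1 - N%:R ^+ 2) / x ^+ 2 * f x - c ^+ 2 * x ^+ 2 * f x.

Definition twice_derivable f x : Prop :=
  (\forall y \near x, derivable f y 1) /\ derivable f^`()%classic x 1.

(* f is of class C^2 on the open interval ]0, 1[; its values elsewhere do not
   matter, since f^`() and f^`(2) on ]0, 1[ only depend on f there. *)
Definition C2_on01 f : Prop :=
  forall x, 0 < x < 1 -> twice_derivable f x /\ {for x, continuous f^`(2)%classic}.

(* [Lop] is singular at 0 and 1, and membership in C^2(]0, 1[) does not control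
   the boundary terms of the integration by parts.
   At 0 the solutions behave like t^(1/2 + N) and t^(1/2 - N), or like sqrt t
   and sqrt t * ln t if N = 0. For N > 0 the second one is excluded by
   f(0) = 0; for N = 0 it has to be excluded separately. *)
Definition no_log_solution_at0 N f : Prop :=
  N = 0%N -> f t / (Num.sqrt t * ln t) @[t --> 0^'+] --> 0.

(* At 1 the solutions behave like 1 and (1 - t)^(- nu) (like ln (1 - t) if
   nu = 0); the vanishing of this weighted derivative, automatic if f is C^1 up
   to t = 1, excludes the second one. *)
Definition no_flux_at1 nu f : Prop :=
  (1 - t ^+ 2) `^ (nu + 1) * f^`()%classic t @[t --> 1^'-] --> 0.

End WeightedFiniteHankel.

(* Main.v *)
Require Import Defs.
From mathcomp Require Import all_boot all_order all_algebra.
From mathcomp Require Import all_classical all_reals all_analysis.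
From mathcomp Require Import measurable_realfun ring lra.
Import Order.TTheory GRing.Theory Num.Theory.
Import numFieldNormedType.Exports.
Local Open Scope classical_set_scope.
Local Open Scope ring_scope.

(** Write K(y) = sqrt y * J_N(y), w(t) = (1 - t^2)^nu, p(t) = (1 - t^2)^(nu + 1),
   and L_x, L_t for the operator L acting on the variable x or t.  Since K solves
   K'' + (1 + (1/4 - N^2) / y^2) K = 0, the function (x, t) |-> K (c x t)
   satisfies L_x K(c x t) = L_t K(c x t): both sides equal
   [1/4 - N^2 - c^2 (x^2 + t^2 - x^2 t^2)] K(y) - 2 (nu + 1) y K'(y) at y = c x t,
   an expression symmetric in x and t.  The theorem therefore reduces to two facts.

   (a) L_x can be moved inside the integral of K(c x t) f(t) w(t)
   ([Lop_hankel]).  The product f w is integrable, because f is square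
   integrable for w and w is integrable for nu > -1.  The functions K, y K'(y)
   and y^2 K''(y) extend continuously to y = 0, even though K' does not when
   N = 0, so the derivatives in x, written through the Euler operator y d/dy,
   are dominated by a multiple of |f w| ([is_derive_kernel_transform]).

   (b) L_t can be moved from K to f ([green_identity]).  As
   L_t f = (p f')' / w + q f with q(t) = (1/4 - N^2) / t^2 - c^2 t^2, Lagrange's
   identity says that w (K L f - f L K) is the derivative of the bracket
   W = p (K f' - (d/dt K) f) ([is_derive_wronskian]).  This derivative is
   integrable on ]0, 1[, hence W has limits at both ends and its integral is
   their difference; both limits have to vanish.

   At t = 1, p f' tends to 0 by assumption, and l'Hopital's rule in its
   infinity-over-infinity form, applied to f / (1 / p), then gives p f --> 0
   ([cvg_weight_f_at1]).

   At t = 0, the quotient g = f / K has derivative W / (p K^2), where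
   K^2 ~ C^2 t^(2 N + 1).  With U' = t^-(2 N + 1), that is U = ln t or
   U = - t^(-2 N) / (2 N), the same rule shows that g / U tends to a nonzero
   multiple of the limit of W.  But continuity with f(0) = 0 for N > 0, and the
   exclusion of the logarithmic solution for N = 0, give
   g / U --> 0 ([wronskian_lim_at0]). *)

Set Implicit Arguments.
Unset Strict Implicit.
Unset Printing Implicit Defensive.

(** * Elementary facts on limits and derivatives *)

Section Preliminaries.
Variable R : realType.

Lemma is_derive_continuous (g : R -> R) (t d : R) :
  is_derive t 1 g d -> {for t, continuous g}.
Proof.
move=> Dg; apply: differentiable_continuous; apply/derivable1_diffP.
exact: (@ex_derive _ _ _ _ _ _ _ Dg).
Qed.

Lemma is_derive_exprn (n : nat) (t : R) : t != 0 ->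
  is_derive t 1 (fun t : R => t ^+ n) (n%:R / t * t ^+ n).
Proof.
move=> t0; elim: n => [|n IH]; first by rewrite !mul0r; exact: is_derive_cst.
under eq_fun do rewrite exprS.
apply: is_derive_eq; rewrite /GRing.scale/= exprS -nat1r.
by field.
Qed.

Lemma cvg_norm_invy (F : set_system R) (FF : Filter F) (k : R -> R) :
  (\forall t \near F, k t != 0) -> k t @[t --> F] --> 0 ->
  `|(k t)^-1| @[t --> F] --> +oo.
Proof.
move=> k0 /cvgr0Pnorm_lt kl; apply/cvgryPge => A.
have A0 : 0 < (`|A| + 1)^-1 by rewrite invr_gt0 ltr_pwDr.
near=> t; have kt0 : 0 < `|k t| by rewrite normr_gt0; near: t.
rewrite normfV -[A]invrK (le_trans _ (_ : `|A| + 1 <= _))//.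
  by rewrite invrK (le_trans (ler_norm A))// lerDl.
rewrite -[leLHS]invrK lef_pV2 ?posrE//.
by apply: ltW; near: t; exact: kl.
Unshelve. all: by end_near. Qed.

End Preliminaries.

(** * Power series dominated by the exponential series *)

Section EntireSeries.
Variable R : realType.
Implicit Types (a : nat -> R) (z : R).

(** A bound on the coefficients that is stable under formal differentiation, so
   that every iterated derived series converges everywhere at once. *)
Definition exp_dominated a := forall k, `|a k| <= (k`!%:R)^-1.

Definition pseries_sum a z : R := limn (pseries a z).

Lemma exp_dominated_diffs a : exp_dominated a -> exp_dominated (pseries_diffs a).
Proof.
move=> ha k; rewrite /pseries_diffs normrM ger0_norm//.
apply: (le_trans (ler_wpM2l _ (ha _)))=> //.
by rewrite factS natrM invfM mulVKf ?pnatr_eq0.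
Qed.

Lemma exp_dominated_cvg a z : exp_dominated a -> cvgn (pseries a z).
Proof.
move=> ha; apply: normed_cvg.
apply: (@series_le_cvg _ _ (exp_coeff `|z|)) => [n|n|n|].
- exact: normr_ge0.
- by apply: exp_coeff_ge0.
- rewrite /exp_coeff /= normrM normrX mulrC ler_wpM2l// exprn_ge0//.
- exact: is_cvg_series_exp_coeff.
Qed.

Lemma is_derive_pseries_sum a z : exp_dominated a ->
  is_derive z 1 (pseries_sum a) (pseries_sum (pseries_diffs a) z).
Proof.
move=> ha; have h1 := exp_dominated_diffs ha; have h2 := exp_dominated_diffs h1.
apply: (@pseries_snd_diffs _ a (`|z| + 1)); try exact: exp_dominated_cvg.
by rewrite [ltRHS]ger0_norm ?addr_ge0// ltrDl.
Qed.

Lemma pseries_sum0 a : pseries_sum a 0 = a 0%N.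
Proof.
apply: lim_near_cst => //; near=> m.
rewrite -[m]prednK; last by near: m.
rewrite /pseries /series /= big_nat_recl// expr0 mulr1 big1_seq ?addr0// => i _.
by rewrite expr0n mulr0.
Unshelve. all: by end_near. Qed.

End EntireSeries.

(** * The function sqrt y * J_N(y) *)

Section Bessel.
Variables (R : realType) (N : nat).

(** J_N(y) = (y / 2)^N E0((y / 2)^2), where E0 has these coefficients; working
   with the entire function E0 keeps the possible singularities at y = 0 in the
   explicit factor [bessel_pow]. *)
Definition bcoef (k : nat) : R := (-1) ^+ k / (k`! * (k + N)`!)%:R.

Definition E0 := pseries_sum bcoef.
Definition E1 := pseries_sum (pseries_diffs bcoef).
Definition E2 := pseries_sum (pseries_diffs (pseries_diffs bcoef)).

Lemma bcoef_dominated : exp_dominated bcoef.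
Proof.
move=> k; rewrite /bcoef normrM normrX normrN1 expr1n mul1r natrM invfM.
rewrite ger0_norm ?mulr_ge0 ?invr_ge0// ler_piMr ?invr_ge0//.
by rewrite invf_le1 ?ltr0n ?fact_gt0// ler1n fact_gt0.
Qed.

Lemma is_derive_E0 (z : R) : is_derive z 1 E0 (E1 z).
Proof. exact/is_derive_pseries_sum/bcoef_dominated. Qed.

Lemma is_derive_E1 (z : R) : is_derive z 1 E1 (E2 z).
Proof. exact/is_derive_pseries_sum/exp_dominated_diffs/bcoef_dominated. Qed.

Lemma bcoefS k : k.+1%:R * (k%:R + N.+1%:R) * bcoef k.+1 = - bcoef k.
Proof.
have f0 m : (m`!%:R : R) != 0 by rewrite pnatr_eq0 -lt0n fact_gt0.
rewrite /bcoef -natrD addnS addSn !factS exprS !natrM.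
field; rewrite !f0 -natrD !nat1r !pnatr_eq0//.
Qed.

(** Bessel's equation after the substitution z = (y / 2)^2: it is the recurrence
   [bcoefS] read coefficientwise. *)
Lemma E0_ode (z : R) : z * E2 z + N.+1%:R * E1 z + E0 z = 0.
Proof.
have h0 := bcoef_dominated; have h1 := exp_dominated_diffs h0.
have h2 := exp_dominated_diffs h1.
have c0 := exp_dominated_cvg (z:=z) h0; have c1 := exp_dominated_cvg (z:=z) h1.
have c2 := pseries_diffs_equiv (exp_dominated_cvg (z:=z) h2).
set s := series _ in c2.
have : z * s n + N.+1%:R * pseries (pseries_diffs bcoef) z n + pseries bcoef z n
  @[n --> \oo] --> z * E2 z + N.+1%:R * E1 z + E0 z.
  apply: cvgD; last exact: c0.
  by apply: cvgD; apply: cvgM => //; exact: cvg_cst.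
move/cvg_lim => <- //.
rewrite (_ : (fun n => _) = cst 0) ?lim_cst//.
apply/funext => n /=; rewrite /s /pseries /series /= !mulr_sumr -!big_split/=.
apply: big1 => i _; rewrite -[bcoef i in X in _ + X = _]opprK -bcoefS /pseries_diffs.
by case: i => [|i] /=; rewrite ?exprS; ring.
Qed.

Definition bessel_pow (y : R) : R := Num.sqrt y * (y / 2) ^+ N.

Definition besselK (y : R) : R := bessel_pow y * E0 ((y / 2) ^+ 2).

(** y d/dy applied to [besselK].  Differentiation in x or t of a function of
   c x t is, up to division by x or t, this Euler operator, and its result is
   continuous at y = 0 although the derivative of [besselK] is not if N = 0. *)
Definition besselEuler (y : R) : R :=
  bessel_pow y * ((N%:R + 2^-1) * E0 ((y / 2) ^+ 2) + 2 * (y / 2) ^+ 2 * E1 ((y / 2) ^+ 2)).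

Lemma sqrt_besselJE y : sqrt_besselJ N y = besselK y.
Proof.
rewrite /sqrt_besselJ /besselK /bessel_pow -mulrA; congr (_ * _).
have c0 := exp_dominated_cvg (z:=(y / 2) ^+ 2) bcoef_dominated.
rewrite /besselJ -[X in series X](_ : (y / 2) ^+ N *: (fun i => bcoef i * ((y / 2) ^+ 2) ^+ i) = _).
  by rewrite lim_seriesZ.
by apply/funext => k; rewrite !fctE exprD exprM /GRing.scale/= /bcoef; ring.
Qed.

Lemma is_derive_bessel_pow (y : R) : 0 < y ->
  is_derive y 1 bessel_pow ((N%:R + 2^-1) / y * bessel_pow y).
Proof.
move=> y0.
have D1 : is_derive y 1 (fun y : R => y / 2) (2^-1).
  by apply: is_derive_eq; rewrite ?scaler0 ?add0r /GRing.scale/= ?mulr1.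
have D2 := is_derive1_sqrt y0.
have D3 : is_derive y 1 (fun y : R => (y / 2) ^+ N) (N%:R / y * (y / 2) ^+ N).
  have y2 : y / 2 != 0 by rewrite gt_eqF// divr_gt0.
  have D := @is_derive1_comp _ (fun z => z ^+ N) (fun y => y / 2) y _ _
    (is_derive_exprn N y2) D1.
  apply: is_derive_eq D _; set z := (y / 2) ^+ N.
  by field; rewrite gt_eqF.
rewrite /bessel_pow; apply: is_derive_eq; rewrite /GRing.scale/=.
have s0 : Num.sqrt y != 0 by rewrite sqrtr_eq0 -ltNge.
have -> : (2 * Num.sqrt y)^-1 = Num.sqrt y / (2 * y).
  by rewrite -{3}(sqr_sqrtr (ltW y0)); field.
by field; rewrite gt_eqF.
Qed.

Lemma is_derive_besselK (y : R) : 0 < y -> is_derive y 1 besselK (besselEuler y / y).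
Proof.
move=> y0; have D1 := is_derive_bessel_pow y0.
have D2 : is_derive y 1 (fun y : R => (y / 2) ^+ 2) (y / 2).
  by apply: is_derive_eq; rewrite /GRing.scale/=; field.
have D3 : is_derive y 1 (fun y => E0 ((y / 2) ^+ 2)) (E1 ((y / 2) ^+ 2) * (y / 2)).
  by apply: is_derive1_comp; exact: is_derive_E0.
rewrite /besselK; apply: is_derive_eq; rewrite /besselEuler /GRing.scale/=.
field; rewrite gt_eqF//.
Qed.

(** Equal to minus y^2 times the second derivative of [besselK]. *)
Definition besselPot (y : R) : R := (y ^+ 2 + 4^-1 - N%:R ^+ 2) * besselK y.

(** The equation K'' = - (1 + (1/4 - N^2) / y^2) K, written for y K'(y). *)
Lemma is_derive_besselEuler (y : R) : 0 < y ->
  is_derive y 1 besselEuler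
    ((besselEuler y - besselPot y) / y).
Proof.
move=> y0; have D1 := is_derive_bessel_pow y0.
have D2 : is_derive y 1 (fun y : R => (y / 2) ^+ 2) (y / 2).
  by apply: is_derive_eq; rewrite /GRing.scale/=; field.
have D3 : is_derive y 1 (fun y => E0 ((y / 2) ^+ 2)) (E1 ((y / 2) ^+ 2) * (y / 2)).
  by apply: is_derive1_comp; exact: is_derive_E0.
have D4 : is_derive y 1 (fun y => E1 ((y / 2) ^+ 2)) (E2 ((y / 2) ^+ 2) * (y / 2)).
  by apply: is_derive1_comp; exact: is_derive_E1.
rewrite /besselEuler; apply: is_derive_eq; rewrite /besselPot /besselK /GRing.scale/=.
have := E0_ode ((y / 2) ^+ 2); set e2 := E2 _; set e1 := E1 _; set e0 := E0 _.
rewrite -[N.+1%:R]nat1r => ode.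
have -> : e0 = - ((y / 2) ^+ 2 * e2 + (1 + N%:R) * e1) by rewrite -[LHS]subr0 -ode; ring.
field; rewrite gt_eqF//.
Qed.

Lemma continuous_E0 : continuous E0.
Proof.
by move=> z; exact: is_derive_continuous (is_derive_E0 z).
Qed.

Lemma continuous_E1 : continuous E1.
Proof.
by move=> z; exact: is_derive_continuous (is_derive_E1 z).
Qed.

Lemma continuous_sqr_half : continuous (fun y : R => (y / 2) ^+ 2).
Proof.
by move=> y; apply: cvgM; apply: cvgM; (exact: cvg_id || exact: cvg_cst).
Qed.

Lemma continuous_bessel_pow : continuous bessel_pow.
Proof.
move=> y; apply: cvgM; first exact: sqrt_continuous.
apply: (cvg_comp (fun z : R => z / 2) (fun z => z ^+ N) _ (@exprn_continuous _ _ _)).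
by apply: cvgM; (exact: cvg_id || exact: cvg_cst).
Qed.

Lemma continuous_besselK : continuous besselK.
Proof.
move=> y; apply: cvgM; first exact: continuous_bessel_pow.
exact: (cvg_comp _ E0 (@continuous_sqr_half y) (@continuous_E0 _)).
Qed.

Lemma continuous_besselEuler : continuous besselEuler.
Proof.
move=> y; apply: cvgM; first exact: continuous_bessel_pow.
apply: cvgD; apply: cvgM.
- exact: cvg_cst.
- exact: (cvg_comp _ E0 (@continuous_sqr_half y) (@continuous_E0 _)).
- by apply: cvgM; [exact: cvg_cst|exact: continuous_sqr_half].
- exact: (cvg_comp _ E1 (@continuous_sqr_half y) (@continuous_E1 _)).
Qed.

Lemma continuous_besselPot : continuous besselPot.
Proof.
move=> y; apply: cvgM; last exact: continuous_besselK.
apply: cvgB; last exact: cvg_cst.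
by apply: cvgD; [exact: exprn_continuous|exact: cvg_cst].
Qed.

Lemma E0_0 : E0 0 = (N`!%:R)^-1.
Proof. by rewrite /E0 pseries_sum0 /bcoef expr0 add0n fact0 mul1n div1r. Qed.

End Bessel.

(** * L'Hopital's rule, infinity over infinity *)

Section Lhopital.
Variable R : realType.
Implicit Types (h dh U dU : R -> R) (a b m : R).

Lemma cauchy_mvt_le h dh U dU a b e :
  (forall x, x \in `]a, b[ -> is_derive x 1 h (dh x)) ->
  (forall x, x \in `]a, b[ -> is_derive x 1 U (dU x)) ->
  (forall x, x \in `]a, b[ -> dU x != 0) ->
  (forall x, x \in `]a, b[ -> `|dh x / dU x| <= e) ->
  forall s t, s \in `]a, b[ -> t \in `]a, b[ ->
    `|h s - h t| <= e * `|U s - U t|.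
Proof.
move=> hd Ud dU0 le_e s t.
wlog st : s t / s <= t.
  move=> H sab tab; case: (leP s t) => [|/ltW] st; first exact: H.
  by rewrite distrC (distrC (U s)); exact: H.
rewrite !in_itv/= => /andP[as_ sb] /andP[at_ tb].
move: st; rewrite le_eqVlt => /predU1P[->|st]; first by rewrite !subrr normr0 mulr0.
have sub x : x \in `[s, t] -> x \in `]a, b[.
  rewrite !in_itv/= => /andP[sx xt].
  by rewrite (lt_le_trans as_ sx) (le_lt_trans xt tb).
have sub' x : x \in `]s, t[ -> x \in `]a, b[.
  by move=> xst; apply: sub; exact: subset_itv_oo_cc xst.
have ch : {within `[s, t], continuous h}.
  by apply: derivable_within_continuous => x /sub/hd[].
have cU : {within `[s, t], continuous U}.
  by apply: derivable_within_continuous => x /sub/Ud[].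
have hd' x : x \in `]s, t[ -> is_derive x 1 h (dh x) by move=> /sub'/hd.
have Ud' x : x \in `]s, t[ -> is_derive x 1 U (dU x) by move=> /sub'/Ud.
have dU0' x : x \in `]s, t[ -> dU x != 0 by move=> /sub'/dU0.
have U0 := differentiable_subr_neq0 st cU Ud' dU0'.
have [c cst E] := cauchy_MVT st ch cU hd' Ud' dU0'.
rewrite distrC (distrC (U s)) -ler_pdivrMr ?normr_gt0// -normf_div -E.
exact/le_e/sub'.
Qed.

(** If the increments of h are eventually at most e times those of U, then
   |h| <= e |U| + constant, and the constant is negligible against |U|. *)
Lemma cvg0_of_dist_le (F : set_system R) (FF : Filter F) h U :
  (forall e, 0 < e -> exists t1, \forall t \near F,
      `|h t - h t1| <= e * `|U t - U t1|) ->
  `|U t| @[t --> F] --> +oo -> h t / U t @[t --> F] --> 0.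
Proof.
move=> H /cvgryPge Uoo; apply/cvgr0Pnorm_le => e e0.
have e2 : 0 < e / 2 by rewrite divr_gt0.
have [t1 Ht1] := H _ e2.
near=> t.
have : (`|h t1| + e / 2 * `|U t1|) / (e / 2) + 1 <= `|U t| by near: t; exact: Uoo.
have : `|h t - h t1| <= e / 2 * `|U t - U t1| by near: t; exact: Ht1.
set u := `|U t| => hd hu.
have hd' : `|h t| <= `|h t1| + e / 2 * (u + `|U t1|).
  rewrite -[h t](subrK (h t1)) addrC (le_trans (ler_normD _ _))// lerD2l.
  by rewrite (le_trans hd)// ler_pM2l// ler_normB.
set v := _ + _ in hu hd'.
have k0 : 0 <= (`|h t1| + e / 2 * `|U t1|) / (e / 2).
  by rewrite divr_ge0 ?addr_ge0 ?mulr_ge0 ?normr_ge0// ltW.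
have u0 : 0 < u by rewrite (lt_le_trans _ hu)// ltr_pwDr.
rewrite normf_div ler_pdivrMr//.
rewrite (le_trans hd')// mulrDr addrCA [e in leRHS]splitr mulrDl lerD2l.
by rewrite [leRHS]mulrC -ler_pdivrMr//; apply: le_trans hu; rewrite lerDl.
Unshelve. all: by end_near. Qed.

(** Subtracting m U from h reduces the claim to m = 0, where Cauchy's mean value
   theorem bounds the increments of h by those of U. *)
Lemma lhopital_infty_at_right h dh U dU a b (m : R) : a < b ->
  (forall x, x \in `]a, b[ -> is_derive x 1 h (dh x)) ->
  (forall x, x \in `]a, b[ -> is_derive x 1 U (dU x)) ->
  (forall x, x \in `]a, b[ -> dU x != 0) ->
  dh x / dU x @[x --> a^'+] --> m ->
  `|U x| @[x --> a^'+] --> +oo ->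
  h x / U x @[x --> a^'+] --> m.
Proof.
move=> ab hd Ud dU0 /cvgrPdist_le dm Uoo.
pose k x := h x - m * U x; pose dk x := dh x - m * dU x.
have k0 : k x / U x @[x --> a^'+] --> 0.
  apply: cvg0_of_dist_le => // e e0.
  have [d /= d0 Hd] := dm _ e0.
  pose c := Num.min b (a + d).
  have ac : a < c by rewrite lt_min ab ltrDl.
  have sub x : x \in `]a, c[ -> x \in `]a, b[.
    by rewrite !in_itv/= lt_min => /and3P[-> ->].
  have dkP x : x \in `]a, c[ -> is_derive x 1 k (dk x).
    move=> /sub xab; have Dh := hd _ xab; have DU := Ud _ xab.
    by apply: is_deriveB; exact: is_deriveZ.
  have dUc x : x \in `]a, c[ -> is_derive x 1 U (dU x) by move=> /sub /Ud.
  have dU0c x : x \in `]a, c[ -> dU x != 0 by move=> /sub /dU0.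
  have dke x : x \in `]a, c[ -> `|dk x / dU x| <= e.
    move=> xac; have := dU0c _ xac => dUx0.
    move: xac; rewrite in_itv/= lt_min => /and3P[ax xb xd].
    rewrite /dk mulrDl -mulNr mulfK// distrC; apply: Hd => //=.
    by rewrite distrC ger0_norm ?subr_ge0 ?ltW// ltrBlDl.
  have L := cauchy_mvt_le dkP dUc dU0c dke.
  exists ((a + c) / 2).
  near=> t; apply: L.
  - by rewrite in_itv/=; apply/andP; split; near: t; [exact: nbhs_right_gt|exact: nbhs_right_lt].
  - by rewrite in_itv/= !midf_lt.
have : k x / U x + m @[x --> a^'+] --> 0 + m by apply: cvgD => //; exact: cvg_cst.
rewrite add0r; apply: cvg_trans; apply: near_eq_cvg.
near=> x; have U0 : U x != 0.
  have : 1 <= `|U x| by near: x; move/cvgryPge : Uoo; exact.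
  by move=> U1; rewrite -normr_gt0 (lt_le_trans _ U1).
by rewrite /k; field.
Unshelve. all: by end_near. Qed.

Lemma lhopital_infty_at_left h dh U dU a b (m : R) : a < b ->
  (forall x, x \in `]a, b[ -> is_derive x 1 h (dh x)) ->
  (forall x, x \in `]a, b[ -> is_derive x 1 U (dU x)) ->
  (forall x, x \in `]a, b[ -> dU x != 0) ->
  dh x / dU x @[x --> b^'-] --> m ->
  `|U x| @[x --> b^'-] --> +oo ->
  h x / U x @[x --> b^'-] --> m.
Proof.
move=> ab hd Ud dU0 dm Uoo; apply/cvg_at_leftNP.
have hdN x : x \in `]- b, - a[ -> is_derive x 1 (h \o -%R) (dh (- x) * -1).
  by rewrite -oppr_itvoo => xab; apply: is_derive1_comp; exact: hd.
have UdN x : x \in `]- b, - a[ -> is_derive x 1 (U \o -%R) (dU (- x) * -1).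
  by rewrite -oppr_itvoo => xab; apply: is_derive1_comp; exact: Ud.
have dUN0 x : x \in `]- b, - a[ -> dU (- x) * -1 != 0.
  by rewrite -oppr_itvoo => xab; rewrite mulrN1 oppr_eq0 dU0.
have baN : - b < - a by rewrite ltrN2.
have := lhopital_infty_at_right baN hdN UdN dUN0 (m := m); apply.
- move/cvg_at_leftNP : dm; apply: cvg_trans; apply: near_eq_cvg.
  by near=> x; rewrite /= !mulrN1 invrN mulrNN.
- rewrite at_rightN -fmap_comp /comp; under eq_fun do rewrite opprK.
  exact: Uoo.
Unshelve. all: by end_near. Qed.

End Lhopital.

(** * The fundamental theorem of calculus on an open interval *)

Section ImproperFTC.
Variable R : realType.
Notation mu := (@lebesgue_measure R).

Lemma derive0_cst_oo (D : R -> R) (a b : R) :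
  (forall x, x \in `]a, b[ -> is_derive x 1 D 0) ->
  forall s t, s \in `]a, b[ -> t \in `]a, b[ -> D s = D t.
Proof.
move=> D0 s t sab tab.
have Did x : x \in `]a, b[ -> is_derive x (1 : R) (id : R -> R) 1 by move=> _; exact: is_derive_id.
have /= := @cauchy_mvt_le R D (fun=> 0) id (fun=> 1) a b 0 D0 Did
  (fun _ _ => oner_neq0 _) _ s t sab tab.
move=> H; apply/eqP; rewrite -subr_eq0 -normr_le0 (le_trans (H _)) ?mul0r//.
by move=> x _; rewrite ?mul0r normr0.
Qed.

(** Integrability of the derivative forces the antiderivative W to have limits at
   both ends: W differs by a constant from the continuous function
   x |-> \int_a^x h. *)
Lemma improper_FTC (a b : R) (h W : R -> R) : a < b ->
  mu.-integrable `]a, b[ (EFin \o h) ->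
  (forall x, x \in `]a, b[ -> {for x, continuous h}) ->
  (forall x, x \in `]a, b[ -> is_derive x 1 W (h x)) ->
  exists la lb, [/\ W x @[x --> a^'+] --> la, W x @[x --> b^'-] --> lb &
    \int[mu]_(x in `]a, b[) h x = lb - la].
Proof.
move=> ab ih ch hW.
pose h' := h \_ `]a, b[.
have ih' : mu.-integrable `[a, b] (EFin \o h').
  apply: (@integrableS _ _ _ mu setT) => //.
  by rewrite /h' -restrict_EFin; apply/integrable_restrict => //=; rewrite setTI.
pose I x := parameterized_integral mu a x h'.
have intE : \int[mu]_(x in `]a, b[) h x = I b.
  rewrite /I /parameterized_integral -Rintegral_mkcondr.
  by congr (Rintegral _ _ _); rewrite setIidr//; exact: subset_itv_oo_cc.
have hh' x : x \in `]a, b[ -> h' x = h x.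
  by move=> xab; rewrite /h' patchE mem_setE xab.
have ch' x : x \in `]a, b[ -> {for x, continuous h'}.
  move=> xab; have := ch _ xab; rewrite /prop_for /continuous_at hh'//.
  apply: cvg_trans; apply: near_eq_cvg.
  by near=> y; rewrite hh'//; near: y; exact: near_in_itvoo.
have dI x : x \in `]a, b[ -> is_derive x 1 (W - I) 0.
  move=> xab; have := xab; rewrite in_itv/= => /andP[ax xb].
  have [dI IE] := continuous_FTC1_closed xb ih' ax (ch' _ xab).
  have DI : is_derive x 1 I (h x).
    by split; [exact: dI|rewrite -derive1E IE hh'].
  have DW := hW _ xab.
  by apply: is_derive_eq; rewrite subrr.
pose c := (a + b) / 2; have cab : c \in `]a, b[ by rewrite in_itv/= !midf_lt.
have WI x : x \in `]a, b[ -> W x = I x + (W c - I c).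
  by move=> xab; have := derive0_cst_oo dI xab cab; rewrite !fctE => <-; ring.
exists (0 + (W c - I c)), (I b + (W c - I c)); split; last by rewrite intE; ring.
- have : I x + (W c - I c) @[x --> a^'+] --> 0 + (W c - I c).
    apply: cvgD; last exact: cvg_cst.
    by apply: cvg_at_right_filter; exact: parameterized_integral_cvg_left ih'.
  apply: cvg_trans; apply: near_eq_cvg; near=> x; apply/esym/WI.
  by rewrite in_itv/=; apply/andP; split; near: x; [exact: nbhs_right_gt|exact: nbhs_right_lt].
- have : I x + (W c - I c) @[x --> b^'-] --> I b + (W c - I c).
    apply: cvgD; last exact: cvg_cst.
    by exact: parameterized_integral_cvg_at_left ih'.
  apply: cvg_trans; apply: near_eq_cvg; near=> x; apply/esym/WI.
  by rewrite in_itv/=; apply/andP; split; near: x; [exact: nbhs_left_gt|exact: nbhs_left_lt].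
Unshelve. all: by end_near. Qed.

End ImproperFTC.

(** * Integrability of the weight *)

Section Integrability.
Variable R : realType.
Notation mu := (@lebesgue_measure R).

(** Monotone convergence along the segments [a, b - 1 / (n + 1)], on which the
   integral of h is an increment of V. *)
Lemma bounded_antiderivative_integrable (a b C : R) (h V : R -> R) :
  (forall x, x \in `[a, b[ -> 0 <= h x) ->
  (forall x, x \in `[a, b[ -> {for x, continuous h}) ->
  (forall x, x \in `[a, b[ -> is_derive x 1 V (h x)) ->
  (forall x, x \in `[a, b[ -> V x - V a <= C) ->
  mu.-integrable `[a, b[ (EFin \o h).
Proof.
move=> h0 hc hV VC; have [ab|ba] := ltP a b; last first.
  by rewrite set_itv_ge -?leNgt//; exact: integrable_set0.
have C0 : 0 <= C by have := VC a; rewrite subrr; apply; rewrite in_itv/= lexx.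
have mh : measurable_fun (`[a, b[ : set R) h.
  apply/measurable_fun_itv_obnd_cbndP.
  apply: open_continuous_measurable_fun; first exact: interval_open.
  by move=> x; rewrite inE/= => xab; apply: hc; exact: subset_itv_oo_co xab.
apply/integrableP; split; first exact/measurable_EFinP.
have -> : (\int[mu]_(x in `[a, b[) `|(EFin \o h) x| = \int[mu]_(x in `[a, b[) (h x)%:E)%E.
  by apply: eq_integral => x; rewrite inE/= => xab; rewrite ger0_norm// h0.
rewrite (@le_lt_trans _ _ C%:E) ?ltry//.
rewrite itv_bnd_open_bigcup in mh *.
pose F n := `[a, b - n.+1%:R^-1]%classic.
have cvgF : (\int[mu]_(x in F i) (h x)%:E @[i --> \oo] -->
    \int[mu]_(x in \bigcup_i F i) (h x)%:E)%E.
  apply: ge0_nondecreasing_set_cvg_integral => //.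
  - move=> m n mn; rewrite subsetEset; apply: subset_itvl; rewrite bnd_simp.
    by rewrite lerD2l lerN2 lef_pV2 ?posrE// ler_nat ltnS.
  - by move=> n; exact: measurable_itv.
  - move=> n; apply/measurable_EFinP; apply: measurable_funS mh => //; first exact: bigcup_measurable.
    exact: bigcup_sup.
  - move=> n x xF; rewrite lee_fin h0//.
    have : (\bigcup_i F i) x by exists n.
    by rewrite -itv_bnd_open_bigcup.
rewrite -(cvg_lim _ cvgF)//; apply: lime_le; first by apply/cvg_ex; eexists; exact: cvgF.
apply: nearW => n; set d := b - n.+1%:R^-1.
have db : d < b by rewrite ltrBlDr ltrDl invr_gt0.
have [ad|da] := ltP a d; last first.
  move: da; rewrite /F le_eqVlt -/d => /predU1P[->|da].
    by rewrite set_itv1 integral_set1 lee_fin.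
  by rewrite set_itv_ge ?bnd_simp -?ltNge// integral_set0 lee_fin.
have sub x : x \in `[a, d] -> x \in `[a, b[.
  by rewrite !in_itv/= => /andP[-> /le_lt_trans]; exact.
rewrite /F -/d (@continuous_FTC2 _ h V)//.
- by rewrite -EFinB lee_fin VC// in_itv/= db ltW.
- by apply: continuous_in_subspaceT => x; rewrite inE/= => /sub/hc.
- have cV : {within `[a, d], continuous V}.
    by apply: derivable_within_continuous => x /sub/hV[].
  have /continuous_within_itvP := cV => /(_ ad)[_ ? ?]; split => //.
  by move=> x xad; have [] := hV x (sub _ (subset_itv_oo_cc xad)).
- move=> x xad; rewrite derive1E.
  by have [_ ->] := hV x (sub _ (subset_itv_oo_cc xad)).
Qed.

Lemma is_derive_weight (a t : R) : t ^+ 2 < 1 ->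
  is_derive t 1 (fun t : R => (1 - t ^+ 2) `^ a)
    (- (2 * a * t * (1 - t ^+ 2) `^ (a - 1))).
Proof.
move=> t1; have D1 : is_derive t 1 (fun t : R => 1 - t ^+ 2) (- (2 * t)).
  by apply: is_derive_eq; rewrite /GRing.scale/=; ring.
have t0 : 0 < 1 - t ^+ 2 by rewrite subr_gt0.
have D2 := is_derive1_powR a t0.
have D := @is_derive1_comp _ (@powR R ^~ a) (fun t => 1 - t ^+ 2) t _ _ D2 D1.
rewrite (_ : - _ = a * (1 - t ^+ 2) `^ (a - 1) * - (2 * t)); last by ring.
exact: D.
Qed.

Lemma continuous_weight (a t : R) : t ^+ 2 < 1 ->
  {for t, continuous (fun t : R => (1 - t ^+ 2) `^ a)}.
Proof.
move=> t1; exact: is_derive_continuous (is_derive_weight a t1).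
Qed.

(** The function t w(t) has the antiderivative - p(t) / (2 (nu + 1)), which is
   bounded since nu + 1 > 0, and w = (1 - t^2) w + t^2 w <= 1 + t w. *)
Lemma weight_integrable (nu : R) : -1 < nu ->
  mu.-integrable `]0, 1[ (EFin \o weight nu).
Proof.
move=> hnu.
have nu0 : 0 < nu + 1 by rewrite -ltrBlDr sub0r.
have sq1 (x : R) : x \in `[0, 1[ -> x ^+ 2 < 1.
  by rewrite in_itv/= => /andP[x0 x1]; rewrite expr_lt1.
have itw : mu.-integrable `[0, 1[ (EFin \o (fun t => t * weight nu t)).
  apply: (@bounded_antiderivative_integrable _ _ (2 * (nu + 1))^-1 _
    (fun t => - (2 * (nu + 1))^-1 * (1 - t ^+ 2) `^ (nu + 1))).
  - by move=> x; rewrite in_itv/= => /andP[x0 _]; rewrite mulr_ge0// powR_ge0.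
  - move=> x /sq1 x1; apply: cvgM; first exact: cvg_id.
    exact: continuous_weight.
  - move=> x /sq1 x1; have := is_derive_weight (nu + 1) x1 => D.
    apply: is_derive_eq; rewrite /GRing.scale/= addrK /weight.
    by field; rewrite gt_eqF.
  - move=> x _; rewrite expr0n/= subr0 powR1 mulr1 opprK mulNr.
    by rewrite gerDr oppr_le0 mulr_ge0 ?powR_ge0// invr_ge0 mulr_ge0// ltW.
have itw' : mu.-integrable `]0, 1[ (EFin \o (fun t => t * weight nu t)).
  by apply: integrableS itw => //; exact: subset_itv_oo_co.
have i1 : mu.-integrable `]0, 1[ (EFin \o cst 1).
  apply: measurable_bounded_integrable => //.
  - by rewrite /= lebesgue_measure_itv/= lte_fin ltr01 EFinN oppe0 adde0 ltry.
  - by exists 1; split => // M M1 x _; rewrite /= normr1 ltW.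
have mw : measurable_fun (`]0, 1[ : set R) (weight nu).
  apply: open_continuous_measurable_fun; first exact: interval_open.
  move=> x; rewrite inE/= => x01; apply: continuous_weight.
  by apply: sq1; exact: subset_itv_oo_co x01.
apply: le_integrable (integrableD _ i1 itw') => //; first exact/measurable_EFinP.
move=> t /=; rewrite in_itv/= => /andP[t0 t1].
have wp : weight nu t = (1 - t ^+ 2) `^ (nu + 1) + t * (t * weight nu t).
  rewrite /weight powRD ?powRr1; first by ring.
    by rewrite subr_ge0 expr_le1 ?ltW.
  by rewrite (gt_eqF nu0).
have w0 : 0 <= weight nu t by exact: powR_ge0.
have tw0 : 0 <= t * weight nu t by rewrite mulr_ge0// ltW.
rewrite lee_fin !ger0_norm ?addr_ge0// {1}wp lerD//.
  have u0 : 0 <= 1 - t ^+ 2 by rewrite subr_ge0 expr_le1 ?ltW.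
  have u1 : 1 - t ^+ 2 <= 1 by rewrite gerBl sqr_ge0.
  have := ge0_ler_powR (ltW nu0) _ _ u1.
  by rewrite powR1 !nnegrE; apply.
by rewrite ler_piMl// ltW.
Qed.

(** |f| <= 1 + f^2, and both w and f^2 w are integrable. *)
Lemma mul_weight_integrable (nu : R) (f : R -> R) : -1 < nu -> in_L2 nu f ->
  mu.-integrable `]0, 1[ (EFin \o (fun t => f t * weight nu t)).
Proof.
move=> hnu [mf if2]; have iw := weight_integrable hnu.
have mw : measurable_fun (`]0, 1[ : set R) (weight nu).
  by apply/measurable_EFinP; exact: measurable_int iw.
apply: le_integrable (integrableD _ iw if2) => //.
  by apply/measurable_EFinP; exact: measurable_funM.
move=> t _; have w0 : 0 <= weight nu t by exact: powR_ge0.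
have fw0 : 0 <= f t ^+ 2 * weight nu t by rewrite mulr_ge0// sqr_ge0.
rewrite lee_fin [leRHS]ger0_norm ?addr_ge0// normrM (ger0_norm w0).
rewrite -{2}[weight nu t]mul1r -mulrDl ler_wpM2r//.
have /= := sqr_ge0 (`|f t| - 1); rewrite sqrrB mulr1 expr1n -normrX ger0_norm ?sqr_ge0//.
by have := normr_ge0 (f t); lra.
Qed.

End Integrability.

(** * Differentiation of integral transforms with kernel k(c x t) *)

Section KernelTransform.
Variable R : realType.
Notation mu := (@lebesgue_measure R).

Lemma continuous_bounded_segment (k : R -> R) (A : R) : 0 <= A -> continuous k ->
  exists2 M : R, 0 <= M & forall y : R, 0 <= y <= A -> `|k y| <= M.
Proof.
move=> A0 ck.
have [||y0 _ H] := @EVT_max R (fun y => `|k y|) 0 A => //.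
  by apply: continuous_subspaceT => y; apply: cvg_norm; exact: ck.
by exists (`|k y0|) => // y yA; apply: H; rewrite in_itv/=.
Qed.

Variables (phi : R -> R) (c : R).
Hypothesis iphi : mu.-integrable `]0, 1[ (EFin \o phi).
Hypothesis c0 : 0 < c.

Definition kernel_transform (k : R -> R) (x : R) : R :=
  \int[mu]_(t in `]0, 1[) (k (c * x * t) * phi t).

Lemma kernel_transform_integrable (k : R -> R) (x : R) : continuous k -> 0 <= x ->
  mu.-integrable `]0, 1[ (EFin \o (fun t => k (c * x * t) * phi t)).
Proof.
move=> ck x0.
have cx0 : 0 <= c * x by rewrite mulr_ge0// ltW.
have [M M0 HM] := continuous_bounded_segment cx0 ck.
have mk : measurable_fun (`]0, 1[ : set R) (fun t => k (c * x * t)).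
  apply: measurable_funTS; apply: continuous_measurable_fun => t.
  apply: (cvg_comp (fun t => c * x * t) k _ (ck _)).
  by apply: cvgM; [exact: cvg_cst|exact: cvg_id].
have bk : [bounded k (c * x * t) | t in `]0, 1[%classic].
  exists M; split; first exact: num_real.
  move=> M' MM' t /=; rewrite in_itv/= => /andP[t0 t1].
  rewrite (le_trans _ (ltW MM'))//; apply: HM.
  by apply/andP; split; [rewrite mulr_ge0// ltW|rewrite ler_piMr// ltW].
have := @integrableMr _ _ _ mu _ (measurable_itv _) _ _ mk bk iphi.
exact.
Qed.

(** For x' in ]x/2, 2x[ the derivative in x' of the integrand is
   l(c x' t) phi(t) / x', bounded by (2 / x) max_[0, 2cx] |l| * |phi(t)|: the
   hypothesis is on l(y) = y k'(y) so that no singularity of k' at 0 is seen. *)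
Lemma is_derive_kernel_transform (k l : R -> R) (x : R) :
  (forall y : R, 0 < y -> is_derive y 1 k (l y / y)) ->
  continuous k -> continuous l -> 0 < x ->
  is_derive x 1 (kernel_transform k) (kernel_transform l x / x).
Proof.
move=> kl ck cl x0.
pose F x t := k (c * x * t) * phi t.
have x2 : 0 <= c * (2 * x) by rewrite !mulr_ge0// ltW.
have [M M0 HM] := continuous_bounded_segment x2 cl.
have dF (z t : R) : 0 < z -> 0 < t -> is_derive z 1 (F ^~ t) (l (c * z * t) / z * phi t).
  move=> z0 t0; rewrite /F.
  have D1 : is_derive z 1 (fun z => c * z * t) (c * t).
    by apply: is_derive_eq; rewrite /GRing.scale/=; ring.
  have D2 := kl (c * z * t) (mulr_gt0 (mulr_gt0 c0 z0) t0).
  have D3 := @is_derive1_comp _ k (fun z => c * z * t) z _ _ D2 D1.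
  have D4 : is_derive z 1 (fun z => k (c * z * t)) (l (c * z * t) / (c * z * t) * (c * t)) := D3.
  apply: is_derive_eq; rewrite /GRing.scale/=.
  by field; rewrite !gt_eqF.
have xI : x \in `](x / 2), (2 * x)[.
  by rewrite in_itv/=; apply/andP; split; lra.
have zP (z : R) : z \in `](x / 2), (2 * x)[ -> [/\ 0 < z, x / 2 < z & z < 2 * x].
  by rewrite in_itv/= => /andP[h1 h2]; split => //; lra.
have tP (t : R) : `]0, 1[%classic t -> 0 < t /\ t < 1.
  by rewrite /= in_itv/= => /andP[].
have intF (z : R) : `](x / 2), (2 * x)[%classic z -> mu.-integrable `]0, 1[ (EFin \o F z).
  by move=> /zP[z0 _ _]; apply: kernel_transform_integrable => //; exact: ltW.
have derF (z t : R) : `](x / 2), (2 * x)[%classic z -> `]0, 1[%classic t -> derivable (F ^~ t) z 1.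
  by move=> /zP[z0 _ _] /tP[t0 _]; have [] := dF _ _ z0 t0.
have d1F (z t : R) : 0 < z -> 0 < t -> partial1of2 F z t = l (c * z * t) / z * phi t.
  by move=> z0 t0; rewrite partial1of2E; have [] := dF _ _ z0 t0.
pose G t := M * (2 / x) * `|phi t|.
have G0 t : 0 <= G t by rewrite !mulr_ge0// invr_ge0 ltW.
have iG : mu.-integrable `]0, 1[ (EFin \o G).
  have := @integrableZl _ _ _ mu _ _ (M * (2 / x)) _ (integrable_norm iphi).
  exact.
have GF (z t : R) : `](x / 2), (2 * x)[%classic z -> `]0, 1[%classic t -> `|partial1of2 F z t| <= G t.
  move=> /zP[z0 xz zx] /tP[t0 t1]; rewrite d1F// !normrM ler_wpM2r// ler_pM//.
    apply: HM; apply/andP; split; first by rewrite !mulr_ge0// ltW.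
    by rewrite -mulrA ler_pM2l// -[leRHS]mulr1 ler_pM// ltW.
  rewrite normfV gtr0_norm// -[2 / x]invf_div lef_pV2 ?posrE// ?divr_gt0//.
  exact: ltW.
have H1 := @derivable_under_integral _ _ _ mu F _ (measurable_itv _) x (x / 2) (2 * x) xI intF derF G G0 iG GF.
have H2 := @differentiation_under_integral _ _ _ mu F _ (measurable_itv _) x (x / 2) (2 * x) xI intF derF G G0 iG GF.
split; first exact: H1.
rewrite -derive1E; apply: (eq_trans H2); rewrite /kernel_transform -RintegralZr//; last first.
  by apply: kernel_transform_integrable => //; exact: ltW.
apply: eq_Rintegral => t; rewrite inE => /tP[t0 _].
by rewrite d1F//; ring.
Qed.

End KernelTransform.

(** * Applying L to the Hankel transform *)

Section Hankel.
Variable R : realType.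
Notation mu := (@lebesgue_measure R).
Variables (nu c : R) (N : nat) (f : R -> R).
Hypothesis hnu : -1 < nu.
Hypothesis hc : 0 < c.
Hypothesis fL2 : in_L2 nu f.

Local Notation phi := (fun t => f t * weight nu t).
Local Notation T := (kernel_transform phi c).
Local Notation K := (@besselK R N).
Local Notation Eul := (@besselEuler R N).
Local Notation Pot := (@besselPot R N).

Lemma hankelE : hankel c N nu f = T K.
Proof.
apply/funext => x; apply: eq_Rintegral => t _.
by rewrite /hankel_integrand sqrt_besselJE mulrA.
Qed.

Let iphi : mu.-integrable `]0, 1[ (EFin \o phi) := mul_weight_integrable hnu fL2.

Lemma is_derive_hankel (x : R) : 0 < x ->
  is_derive x 1 (hankel c N nu f) (T Eul x / x).
Proof.
move=> x0; rewrite hankelE.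
exact: (is_derive_kernel_transform iphi hc (@is_derive_besselK R N)
  (@continuous_besselK R N) (@continuous_besselEuler R N) x0).
Qed.

Lemma is_derive_hankel_euler (x : R) : 0 < x ->
  is_derive x 1 (fun z => T Eul z / z) (- T Pot x / x ^+ 2).
Proof.
move=> x0.
have D1 : is_derive x 1 (T Eul) (T (fun y => Eul y - Pot y) x / x).
  have cMP : continuous (fun y => Eul y - Pot y).
    by move=> y; apply: cvgB; [exact: continuous_besselEuler|exact: continuous_besselPot].
  exact: (is_derive_kernel_transform iphi hc (@is_derive_besselEuler R N)
    (@continuous_besselEuler R N) cMP x0).
have x0' : x != 0 by rewrite gt_eqF.
have D2 : is_derive x 1 (fun z : R => z^-1) (- x ^- 2).
  have := @is_deriveV R id x 1 1 x0' (is_derive_id x 1).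
  by rewrite /GRing.scale/= mulr1.
apply: is_derive_eq; rewrite /GRing.scale/=.
have -> : T (fun y => Eul y - Pot y) x = T Eul x - T Pot x.
  rewrite /kernel_transform -RintegralB//; last 2 first.
  - exact: (kernel_transform_integrable iphi hc (@continuous_besselEuler R N) (ltW x0)).
  - exact: (kernel_transform_integrable iphi hc (@continuous_besselPot R N) (ltW x0)).
  by apply: eq_Rintegral => t _; rewrite mulrBl.
by field.
Qed.

Lemma derive1_hankel (x : R) : 0 < x -> (hankel c N nu f)^`()%classic x = T Eul x / x.
Proof. by move=> x0; rewrite derive1E; have [] := is_derive_hankel x0. Qed.

Lemma is_derive_hankel' (x : R) : 0 < x ->
  is_derive x 1 (hankel c N nu f)^`()%classic (- T Pot x / x ^+ 2).
Proof.
move=> x0; apply: near_eq_is_derive (is_derive_hankel_euler x0).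
by near=> z; rewrite derive1_hankel//; near: z; exact: lt_nbhsr.
Unshelve. all: by end_near. Qed.

Lemma twice_derivable_hankel (x : R) : 0 < x -> twice_derivable (hankel c N nu f) x.
Proof.
move=> x0; split; last by have [] := is_derive_hankel' x0.
near=> z; have z0 : 0 < z by near: z; exact: lt_nbhsr.
by have [] := is_derive_hankel z0.
Unshelve. all: by end_near. Qed.

(** L_x K(c x t), as a function of x and y = c x t; the second derivative has
   been eliminated by means of the differential equation of K. *)
Definition Lkernel (x y : R) : R :=
  - (1 - x ^+ 2) / x ^+ 2 * Pot y - 2 * (nu + 1) * Eul y
  + ((4^-1 - N%:R ^+ 2) / x ^+ 2 - c ^+ 2 * x ^+ 2) * K y.

Lemma continuous_Lkernel (x : R) : continuous (Lkernel x).
Proof.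
move=> y; apply: cvgD; first apply: cvgB; apply: cvgM;
  (exact: cvg_cst || exact: continuous_besselPot || exact: continuous_besselEuler || exact: continuous_besselK).
Qed.

(** The two derivatives of the transform are again transforms, with kernels
   y K'(y) and y^2 K''(y), so that L acts on the kernel. *)
Lemma Lop_hankel (x : R) : 0 < x -> Lop c N nu (hankel c N nu f) x = T (Lkernel x) x.
Proof.
move=> x0; have x0' : x != 0 by rewrite gt_eqF.
have ik (k : R -> R) : continuous k -> mu.-integrable `]0, 1[ (EFin \o (fun t => k (c * x * t) * phi t)).
  by move=> ck; exact: (kernel_transform_integrable iphi hc ck (ltW x0)).
have iP := ik _ (@continuous_besselPot R N).
have iM := ik _ (@continuous_besselEuler R N).
have iK := ik _ (@continuous_besselK R N).
have iZ (a : R) (k : R -> R) : mu.-integrable `]0, 1[ (EFin \o k) -> mu.-integrable `]0, 1[ (EFin \o (fun t => a * k t)).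
  by move=> ki; have := @integrableZl _ _ _ mu _ (measurable_itv _) a _ ki; exact.
have iS (k1 k2 : R -> R) : mu.-integrable `]0, 1[ (EFin \o k1) ->
    mu.-integrable `]0, 1[ (EFin \o k2) ->
    mu.-integrable `]0, 1[ (EFin \o (fun t => k1 t - k2 t)).
  by move=> i1 i2; have := @integrableB _ _ _ mu _ (measurable_itv _) _ _ i1 i2; exact.
rewrite /Lop derive1nS derive1n1 derive1_hankel//.
rewrite derive1E (@derive_val _ _ _ _ _ _ _ (is_derive_hankel' x0)) hankelE.
have -> : T (Lkernel x) x = - (1 - x ^+ 2) / x ^+ 2 * T Pot x - 2 * (nu + 1) * T Eul x
  + ((4^-1 - N%:R ^+ 2) / x ^+ 2 - c ^+ 2 * x ^+ 2) * T K x.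
  rewrite /kernel_transform -!RintegralZl// -RintegralB//; [|exact: iZ|exact: iZ].
  rewrite -RintegralD//; [|by apply: iS; exact: iZ|exact: iZ].
  by apply: eq_Rintegral => t _; rewrite /Lkernel; ring.
by field.
Qed.

End Hankel.

(** * Green's identity *)

Section Boundary.
Variable R : realType.
Notation mu := (@lebesgue_measure R).
Variables (nu c : R) (N : nat) (f : R -> R).
Hypothesis hnu : -1 < nu.
Hypothesis hc : 0 < c.
Hypothesis fC2 : C2_on01 f.
Local Notation K := (@besselK R N).
Local Notation Eul := (@besselEuler R N).
Local Notation f1 := (f^`()%classic).
Local Notation f2 := (f^`(2)%classic).
Variable x : R.
Hypothesis x0 : 0 < x.

Lemma is_derive_f (t : R) : 0 < t < 1 -> is_derive t 1 f (f1 t).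
Proof.
move=> t01; have [[dft _] _] := fC2 t01.
split; first exact: nbhs_singleton dft.
by rewrite derive1E.
Qed.

Lemma is_derive_f1 (t : R) : 0 < t < 1 -> is_derive t 1 f1 (f2 t).
Proof.
move=> t01; have [[_ dft] _] := fC2 t01.
by split; [exact: dft|rewrite derive1nS derive1n1 derive1E].
Qed.

(** The boundary bracket p (K f' - (d/dt K) f) of Lagrange's identity. *)
Definition wronskian (t : R) : R :=
  (1 - t ^+ 2) `^ (nu + 1) * (K (c * x * t) * f1 t - Eul (c * x * t) / t * f t).

(** Since L_x K = L_t K, this is also w (K L_t f - f L_t K), the density in
   Lagrange's identity. *)
Definition green_density (t : R) : R :=
  K (c * x * t) * Lop c N nu f t * weight nu t
  - Lkernel nu c N x (c * x * t) * (f t * weight nu t).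

Lemma is_derive_scale (k : R -> R) dk (t : R) :
  is_derive (c * x * t) 1 k dk -> is_derive t 1 (fun t => k (c * x * t)) (dk * (c * x)).
Proof.
move=> Dk.
have D1 : is_derive t 1 (fun t => c * x * t) (c * x).
  by apply: is_derive_eq; rewrite /GRing.scale/= mulr1.
exact: (@is_derive1_comp _ k (fun t => c * x * t) t _ _ Dk D1).
Qed.

(** Lagrange's identity combined with L_x K = L_t K; the latter is part of the
   final field computation. *)
Lemma is_derive_wronskian (t : R) : 0 < t < 1 ->
  is_derive t 1 wronskian (green_density t).
Proof.
move=> t01; have /andP[t0 t1] := t01.
have y0 : 0 < c * x * t by rewrite !mulr_gt0.
have Df := is_derive_f t01; have Df1 := is_derive_f1 t01.
have DK := is_derive_scale (is_derive_besselK N y0).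
have DEul := is_derive_scale (is_derive_besselEuler N y0).
have tt : t ^+ 2 < 1 by rewrite expr_lt1// ltW.
have Dp := is_derive_weight (nu + 1) tt.
have t0' : t != 0 by rewrite gt_eqF.
have Dt := @is_deriveV R id t 1 1 t0' (is_derive_id t 1).
have DEult : is_derive t 1 (fun t => Eul (c * x * t) / t) _ := is_deriveM DEul Dt.
have D := is_deriveM Dp (is_deriveB (is_deriveM DK Df1) (is_deriveM DEult Df)).
apply: is_derive_eq D _.
rewrite /green_density /Lop /Lkernel /weight /besselPot /GRing.scale/= !fctE addrK.
have -> : (1 - t ^+ 2) `^ (nu + 1) = (1 - t ^+ 2) * (1 - t ^+ 2) `^ nu.
  rewrite powRD ?powRr1; first by ring.
    by rewrite subr_ge0 ltW.
  by rewrite subr_eq0 (gt_eqF tt) implybT.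
by field; rewrite !gt_eqF.
Qed.

Lemma continuous_f (t : R) : 0 < t < 1 -> {for t, continuous f}.
Proof. by move=> /is_derive_f; exact: is_derive_continuous. Qed.

Lemma continuous_f1 (t : R) : 0 < t < 1 -> {for t, continuous f1}.
Proof. by move=> /is_derive_f1; exact: is_derive_continuous. Qed.

Lemma cvg_scale (k : R -> R) (t : R) : continuous k ->
  k (c * x * z) @[z --> t] --> k (c * x * t).
Proof.
move=> ck; apply: (cvg_comp (fun t => c * x * t) k _ (ck _)).
by apply: cvgM; [exact: cvg_cst|exact: cvg_id].
Qed.

Lemma continuous_green_density (t : R) : 0 < t < 1 ->
  {for t, continuous green_density}.
Proof.
move=> t01; have /andP[t0 t1] := t01.
have tt : t ^+ 2 < 1 by rewrite expr_lt1// ltW.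
have cw : weight nu z @[z --> t] --> weight nu t := continuous_weight (a := nu) tt.
have cK : K (c * x * z) @[z --> t] --> K (c * x * t) := cvg_scale (t := t) (@continuous_besselK R N).
have cL := cvg_scale (t := t) (@continuous_Lkernel R nu c N x).
have cf : f z @[z --> t] --> f t := continuous_f t01.
have cf1 : f1 z @[z --> t] --> f1 t := continuous_f1 t01.
have [_ cf2'] := fC2 t01.
have cf2 : f2 z @[z --> t] --> f2 t := cf2'.
have cid : (z : R) @[z --> t] --> t := @cvg_id _ _.
have csq : z ^+ 2 @[z --> t] --> t ^+ 2 := @exprn_continuous _ 2 t.
have tn : t ^+ 2 != 0 by rewrite expf_neq0// gt_eqF.
have cV : (z ^+ 2)^-1 @[z --> t] --> (t ^+ 2)^-1 by apply: cvgV.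
apply: cvgB; apply: cvgM => //; last exact: cvgM.
apply: cvgM => //; apply: cvgB; first apply: cvgD; first apply: cvgB.
- by apply: cvgM => //; apply: cvgB => //; exact: cvg_cst.
- by apply: cvgM => //; apply: cvgM => //; exact: cvg_cst.
- by apply: cvgM => //; apply: cvgM; [exact: cvg_cst|exact: cV].
- by apply: cvgM => //; apply: cvgM; [exact: cvg_cst|exact: csq].
Qed.

(** * The boundary term at t = 1 *)

Hypothesis fbd1 : no_flux_at1 nu f.

Lemma cvg_weight_at1 : (1 - t ^+ 2) `^ (nu + 1) @[t --> 1^'-] --> (0 : R).
Proof.
have nu0 : 0 < nu + 1 by rewrite -ltrBlDr sub0r.
apply/cvgr0Pnorm_lt => e e0.
have /cvgr0Pnorm_lt /(_ _ e0) := powR_cvg0 nu0.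
move=> [d /= d0 Hd].
have : 1 - t ^+ 2 @[t --> 1^'-] --> (0 : R).
  have -> : (0 : R) = 1 - 1 ^+ 2 by rewrite expr1n subrr.
  apply: cvg_at_left_filter.
  by apply: cvgB; [exact: cvg_cst|exact: exprn_continuous].
move=> /cvgr0Pnorm_lt /(_ _ d0) Hn.
near=> t; apply: Hd => /=.
  by rewrite sub0r normrN; near: t.
have t0 : 0 < t by near: t; exact: nbhs_left_gt.
have t1 : t < 1 by near: t; exact: nbhs_left_lt.
by rewrite subr_gt0 expr_lt1// ltW.
Unshelve. all: by end_near. Qed.

(** L'Hopital's rule for f / (1 / p): the quotient of the derivatives is
   p f' (1 - t^2) / (2 (nu + 1) t), a product of two null functions. *)
Lemma cvg_weight_f_at1 : (1 - t ^+ 2) `^ (nu + 1) * f t @[t --> 1^'-] --> 0.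
Proof.
have nu0 : 0 < nu + 1 by rewrite -ltrBlDr sub0r.
pose U (t : R) := (1 - t ^+ 2) `^ (- (nu + 1)).
pose dU (t : R) := 2 * (nu + 1) * t * (1 - t ^+ 2) `^ (- (nu + 1) - 1).
have h1 : (1 / 2 : R) < 1 by lra.
have itvP (t : R) : t \in `](1 / 2), 1[ -> [/\ 0 < t, t < 1, 0 < t < 1 & t ^+ 2 < 1].
  rewrite in_itv/= => /andP[ta tb].
  have t0 : 0 < t by lra.
  by split => //; [rewrite t0|rewrite expr_lt1// ltW].
have Hf (t : R) : t \in `](1 / 2), 1[ -> is_derive t 1 f (f1 t).
  by move=> /itvP[_ _ t01 _]; exact: is_derive_f.
have HU (t : R) : t \in `](1 / 2), 1[ -> is_derive t 1 U (dU t).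
  move=> /itvP[_ _ _ t1]; apply: is_derive_eq (is_derive_weight _ t1) _.
  by rewrite /dU; ring.
have HU0 (t : R) : t \in `](1 / 2), 1[ -> dU t != 0.
  move=> /itvP[t0 _ _ t1]; rewrite !mulf_neq0// ?gt_eqF// powR_gt0// subr_gt0//.
have Uoo : `|U t| @[t --> 1^'-] --> +oo.
  rewrite /U; under eq_fun do rewrite powRN.
  apply: cvg_norm_invy; last exact: cvg_weight_at1.
  near=> t; have t01 : t \in `](1 / 2), 1[.
    by rewrite in_itv/=; apply/andP; split; near: t; [exact: nbhs_left_gt|exact: nbhs_left_lt].
  by have [_ _ _ t1] := itvP _ t01; rewrite gt_eqF// powR_gt0// subr_gt0.
have dfU : f1 t / dU t @[t --> 1^'-] --> 0.
  have : (1 - t ^+ 2) `^ (nu + 1) * f1 t * ((1 - t ^+ 2) / (2 * (nu + 1) * t)) @[t --> 1^'-] -->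
      0 * ((1 - 1 ^+ 2) / (2 * (nu + 1) * 1)).
    apply: cvgM; first exact: fbd1.
    apply: cvg_at_left_filter; apply: cvgM.
      by apply: cvgB; [exact: cvg_cst|exact: exprn_continuous].
    apply: cvgV; first by rewrite mulr1 mulf_neq0// gt_eqF.
    by apply: cvgM; [exact: cvg_cst|exact: cvg_id].
  rewrite mul0r; apply: cvg_trans; apply: near_eq_cvg.
  near=> t; have t01 : t \in `](1 / 2), 1[.
    by rewrite in_itv/=; apply/andP; split; near: t; [exact: nbhs_left_gt|exact: nbhs_left_lt].
  have [t0 _ _ t1] := itvP _ t01; have tt : 1 - t ^+ 2 != 0 by rewrite subr_eq0 gt_eqF.
  rewrite /dU -opprD powRN (powRD (r := nu + 1)) ?tt ?implybT// powRr1 ?subr_ge0 ?ltW//.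
  have pp : (1 - t ^+ 2) `^ (nu + 1) != 0 by rewrite gt_eqF// powR_gt0// subr_gt0.
  by field; rewrite tt pp !gt_eqF.
have := lhopital_infty_at_left h1 Hf HU HU0 dfU Uoo.
apply: cvg_trans; apply: near_eq_cvg; near=> t.
by rewrite /U powRN invrK mulrC.
Unshelve. all: by end_near. Qed.

Lemma cvg_wronskian_at1 : wronskian t @[t --> 1^'-] --> 0.
Proof.
have : K (c * x * t) * ((1 - t ^+ 2) `^ (nu + 1) * f1 t)
    - Eul (c * x * t) / t * ((1 - t ^+ 2) `^ (nu + 1) * f t) @[t --> 1^'-] -->
    K (c * x * 1) * 0 - Eul (c * x * 1) / 1 * 0.
  apply: cvgB; apply: cvgM.
  - apply: cvg_at_left_filter; exact: (cvg_scale (@continuous_besselK R N)).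
  - exact: fbd1.
  - apply: cvg_at_left_filter; apply: cvgM.
      exact: (cvg_scale (@continuous_besselEuler R N)).
    by apply: cvgV; [exact: oner_neq0|exact: cvg_id].
  - exact: cvg_weight_f_at1.
rewrite !mulr0 subrr; apply: cvg_trans; apply: near_eq_cvg; near=> t.
by rewrite /wronskian; ring.
Unshelve. all: by end_near. Qed.

(** * The boundary term at t = 0 *)

Hypothesis f0 : f 0 = 0.
Hypothesis fcont0 : f t @[t --> 0^'+] --> f 0.
Hypothesis fbd0 : no_log_solution_at0 N f.

(** U is, to leading order at 0 and up to a constant factor, the ratio of the
   singular to the regular solution of L u = 0.  The last clause gathers what is
   known of f at 0: continuity with f(0) = 0 if N > 0, no logarithmic part if
   N = 0. *)
Lemma singular_scale : exists U : R -> R,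
  [/\ forall t : R, 0 < t -> is_derive t 1 U (t ^+ (2 * N + 1))^-1,
      `|U t| @[t --> 0^'+] --> +oo &
      f t / (Num.sqrt t * t ^+ N) / U t @[t --> 0^'+] --> 0].
Proof.
have [N0|N0] := eqVneq N 0%N.
  (* N = 0: U = ln *)
  exists (@ln R); split.
  - by move=> t t0; rewrite N0 muln0 add0n expr1; exact: is_derive1_ln.
  - apply/cvgryPge => A; have := @lnNy R => /cvgrNyPle/(_ (- A)).
    by apply: filterS => t h; rewrite -normrN (le_trans _ (ler_norm _))// lerNr.
  - rewrite N0; under eq_fun do rewrite expr0 mulr1 -mulrA -invfM.
    exact: fbd0.
have N0' : (N%:R : R) != 0 by rewrite pnatr_eq0.
(* N > 0: here f / (sqrt t * t^N * U) = - 2 N f(t) sqrt t * t^(N - 1) *)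
exists (fun t => - (2 * N%:R)^-1 * (t ^+ (2 * N))^-1); split.
- move=> t t0; have t0' : t != 0 by rewrite gt_eqF.
  have tn : t ^+ (2 * N) != 0 by rewrite expf_neq0.
  have D := @is_deriveV R (fun t => t ^+ (2 * N)) t _ 1 tn (is_derive_exprn (2 * N) t0').
  apply: (is_derive_eq (is_deriveZ (- (2 * N%:R)^-1) D)).
  rewrite /GRing.scale/= exprD expr1 natrM.
  by field; rewrite tn t0' N0'.
- under eq_fun do rewrite -[(2 * N%:R)^-1]mul1r -mulrN -invrN mul1r -invfM.
  apply: cvg_norm_invy.
    near=> t; have t0 : 0 < t by near: t; exact: nbhs_right_gt.
    by rewrite mulf_neq0 ?oppr_eq0 ?mulf_neq0// expf_neq0// gt_eqF.
  apply: cvg_at_right_filter.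
  have E : - (2 * N%:R) * 0 ^+ (2 * N) = 0 :> R by rewrite expr0n muln_eq0 (negPf N0) mulr0.
  rewrite -[X in _ --> X]E.
  by apply: cvgM; [exact: cvg_cst|exact: exprn_continuous].
- have : f t * (- (2 * N%:R) * (Num.sqrt t * t ^+ N.-1)) @[t --> 0^'+] -->
      0 * (- (2 * N%:R) * (Num.sqrt 0 * 0 ^+ N.-1)).
    apply: cvgM; first by rewrite -{2}f0.
    apply: cvg_at_right_filter; apply: cvgM; first exact: cvg_cst.
    by apply: cvgM; [exact: sqrt_continuous|exact: exprn_continuous].
  rewrite mul0r; apply: cvg_trans; apply: near_eq_cvg.
  near=> t; have t0 : 0 < t by near: t; exact: nbhs_right_gt.
  have s0 : Num.sqrt t != 0 by rewrite sqrtr_eq0 -ltNge.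
  have ts : t = Num.sqrt t ^+ 2 by rewrite sqr_sqrtr// ltW.
  have tN : t ^+ N = Num.sqrt t ^+ 2 * t ^+ N.-1 by rewrite -ts -exprS prednK// lt0n.
  have tp : t ^+ N.-1 != 0 by rewrite expf_neq0// gt_eqF.
  rewrite mul2n -addnn exprD tN.
  by field; rewrite s0 tp N0'.
Unshelve. all: by end_near. Qed.

(** By l'Hopital's rule, (f / K) / U has the limit l / A(0)^2, where
   K(c x t) = sqrt t * t^N * A(t); but this limit is 0 by [singular_scale]. *)
Lemma wronskian_lim_at0 (l : R) : wronskian t @[t --> 0^'+] --> l -> l = 0.
Proof.
move=> Wl; have [U [dU Uoo fU]] := singular_scale.
pose A (t : R) := Num.sqrt (c * x) * (c * x / 2) ^+ N * E0 N ((c * x * t / 2) ^+ 2).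
have cx0 : 0 < c * x by rewrite mulr_gt0.
have KA t : 0 <= t -> K (c * x * t) = Num.sqrt t * t ^+ N * A t.
  move=> t0; rewrite /besselK /bessel_pow sqrtrM ?ltW// /A.
  have -> : c * x * t / 2 = t * (c * x / 2) by ring.
  by rewrite exprMn; ring.
have cA : A t @[t --> 0^'+] --> A 0.
  apply: cvg_at_right_filter; apply: cvgM; first exact: cvg_cst.
  apply: (cvg_comp (fun t => (c * x * t / 2) ^+ 2) (@E0 R N) _ (@continuous_E0 R N _)).
  exact: (cvg_scale (@continuous_sqr_half R)).
have A0 : A 0 != 0.
  rewrite /A mulr0 mul0r expr0n/= E0_0 !mulf_neq0//.
  - by rewrite sqrtr_eq0 -ltNge.
  - by rewrite expf_neq0// mulf_neq0// ?gt_eqF.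
have : \forall t \near 0^'+, A t != 0.
  have /cvgrPdist_lt /(_ `|A 0|) := cA.
  rewrite normr_gt0 => /(_ A0); apply: filterS => t H.
  by apply: contraTneq H => ->; rewrite subr0 ltxx.
move=> [d /= d0 Hd].
pose b := Num.min d 1.
have b0 : 0 < b by rewrite lt_min d0 ltr01.
have bP t : t \in `]0, b[ -> [/\ 0 < t, 0 < t < 1, t ^+ 2 < 1 & A t != 0].
  rewrite in_itv/= lt_min => /and3P[t0 td t1]; split => //.
  - by rewrite t0.
  - by rewrite expr_lt1// ltW.
  - by apply: Hd => //=; rewrite sub0r normrN gtr0_norm.
have near_b : \forall t \near 0^'+, t \in `]0, b[.
  near=> t; rewrite in_itv/=; apply/andP.
  by split; near: t; [exact: nbhs_right_gt|exact: nbhs_right_lt].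
have s0 (t : R) : 0 < t -> Num.sqrt t != 0 by move=> t0; rewrite sqrtr_eq0 -ltNge.
have K0 t : t \in `]0, b[ -> K (c * x * t) != 0.
  move=> /bP[t0 _ _ At]; rewrite KA ?ltW//; apply: mulf_neq0 => //.
  by apply: mulf_neq0; [exact: s0|rewrite expf_neq0// gt_eqF].
pose g t := f t / K (c * x * t).
pose dg t := (f1 t * K (c * x * t) - f t * (Eul (c * x * t) / t)) / K (c * x * t) ^+ 2.
have Dg (t : R) : t \in `]0, b[ -> is_derive t 1 g (dg t).
  move=> tb; have [t0 t01 _ _] := bP _ tb.
  have DK := is_derive_scale (is_derive_besselK N (mulr_gt0 cx0 t0)).
  have D := is_deriveM (is_derive_f t01) (@is_deriveV R (fun t => K (c * x * t)) t _ 1 (K0 _ tb) DK).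
  apply: is_derive_eq D _; rewrite /dg /GRing.scale/=.
  by field; rewrite K0//= !gt_eqF.
have DU (t : R) : t \in `]0, b[ -> is_derive t 1 U (t ^+ (2 * N + 1))^-1.
  by move=> /bP[t0 _ _ _]; exact: dU.
have DU0 (t : R) : t \in `]0, b[ -> (t ^+ (2 * N + 1))^-1 != 0.
  by move=> /bP[t0 _ _ _]; rewrite invr_eq0 expf_neq0// gt_eqF.
have lim1 : dg t / (t ^+ (2 * N + 1))^-1 @[t --> 0^'+] --> l / ((1 - 0 ^+ 2) `^ (nu + 1) * A 0 ^+ 2).
  have : wronskian t / ((1 - t ^+ 2) `^ (nu + 1) * A t ^+ 2) @[t --> 0^'+] -->
      l / ((1 - 0 ^+ 2) `^ (nu + 1) * A 0 ^+ 2).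
    apply: cvgM => //; apply: cvgV.
      by rewrite expr0n/= subr0 powR1 mul1r expf_neq0.
    apply: cvgM.
      by apply: cvg_at_right_filter; apply: continuous_weight; rewrite expr0n ltr01.
    exact: (cvg_comp _ _ cA (@exprn_continuous _ 2 _)).
  apply: cvg_trans; apply: near_eq_cvg; near=> t.
  have tb : t \in `]0, b[ by near: t; exact: near_b.
  have [t0 t01 tt At] := bP _ tb.
  have pp : (1 - t ^+ 2) `^ (nu + 1) != 0 by rewrite gt_eqF// powR_gt0// subr_gt0.
  have ts : Num.sqrt t ^+ 2 = t by rewrite sqr_sqrtr// ltW.
  have K2 : K (c * x * t) ^+ 2 = t * t ^+ (2 * N) * A t ^+ 2.
    by rewrite KA ?ltW//; move: (A t) => a; rewrite !exprMn ts -exprM (mulnC N).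
  rewrite /dg /wronskian invrK K2 exprD expr1; move: (A t) At => a At.
  have tN : t ^+ (2 * N) != 0 by rewrite expf_neq0// gt_eqF.
  by field; rewrite pp At tN gt_eqF.
have lim0 : g t / U t @[t --> 0^'+] --> 0.
  have : f t / (Num.sqrt t * t ^+ N) / U t / A t @[t --> 0^'+] --> 0 / A 0.
    by apply: cvgM => //; exact: cvgV.
  rewrite mul0r; apply: cvg_trans; apply: near_eq_cvg; near=> t.
  have t0 : 0 < t by near: t; exact: nbhs_right_gt.
  by rewrite /g KA ?ltW// (invfM _ (A t)); ring.
have lim1' := lhopital_infty_at_right b0 Dg DU DU0 lim1 Uoo.
have /eqP : l / ((1 - 0 ^+ 2) `^ (nu + 1) * A 0 ^+ 2) = 0 by exact: cvg_unique lim1' lim0.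
rewrite expr0n/= subr0 powR1 mul1r mulf_eq0 invr_eq0 expf_eq0 (negPf A0) andbF orbF.
by move/eqP.
Unshelve. all: by end_near. Qed.

(** * Moving L from f to the kernel *)

Hypothesis fL2 : in_L2 nu f.
Hypothesis hdef : hankel_defined c N nu (Lop c N nu f) x.

(** The integral of [green_density] is the difference of the limits of
   [wronskian] at the two ends, and both limits vanish. *)
Lemma green_identity :
  hankel c N nu (Lop c N nu f) x = kernel_transform (fun t => f t * weight nu t) c (Lkernel nu c N x) x.
Proof.
have i1 : mu.-integrable `]0, 1[ (EFin \o (fun t => K (c * x * t) * Lop c N nu f t * weight nu t)).
  by move: hdef; congr (integrable _ _ _); apply/funext => t; rewrite /hankel_integrand sqrt_besselJE.
have i2 := kernel_transform_integrable (mul_weight_integrable hnu fL2) hc (@continuous_Lkernel R nu c N x) (ltW x0).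
have ig : mu.-integrable `]0, 1[ (EFin \o green_density).
  by have := @integrableB _ _ _ mu _ (measurable_itv _) _ _ i1 i2; exact.
have cg t : t \in `]0, 1[ -> {for t, continuous green_density}.
  by rewrite in_itv/= => t01; exact: continuous_green_density.
have dW (t : R) : t \in `]0, 1[ -> is_derive t 1 wronskian (green_density t).
  by rewrite in_itv/= => t01; exact: is_derive_wronskian.
have [la [lb [Wa Wb E]]] := improper_FTC ltr01 ig cg dW.
have la0 := wronskian_lim_at0 Wa.
have lb0 : lb = 0 by apply: cvg_unique Wb cvg_wronskian_at1.
move: E; rewrite la0 lb0 subrr /green_density RintegralB// => /eqP.
rewrite subr_eq0 /kernel_transform => /eqP <-; apply: eq_Rintegral => t _.
by rewrite /hankel_integrand sqrt_besselJE.
Qed.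

End Boundary.

(** * Commutation of the transform and the operator *)

Theorem theorem3p2 (R : realType) (nu c : R) (N : nat) (f : R -> R)
    (hnu : -1 < nu) (hc : 0 < c)
    (fC2 : C2_on01 f)
    (f0 : f 0 = 0) (fcont0 : f t @[t --> 0^'+] --> f 0)
    (fL2 : in_L2 nu f)
    (fbd0 : no_log_solution_at0 N f) (fbd1 : no_flux_at1 nu f) :
  forall x : R, 0 < x < 1 ->
    hankel_defined c N nu (Lop c N nu f) x ->
    twice_derivable (hankel c N nu f) x /\
    hankel c N nu (Lop c N nu f) x = Lop c N nu (hankel c N nu f) x.
Proof.
move=> x /andP[x0 _] hdef.
split; first exact: twice_derivable_hankel.
by rewrite Lop_hankel// green_identity.
Qed.
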